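(* Let $K\ge1$, $m=2^K-1$ and $B=2^{2^K}$. The factor complexity of the infinite word $a_m(0)a_m(1)\cdots$ satisfies $p_{a_m}(n)=2n$ for $1\le n\le B+1$, and for every $j\ge1$: \[ p_{a_m}(n)=4n-2(B^j-B^{j-1}+2)\quad\text{for } B^j+2\le n\le 2B^j-B^{j-1}+1, \] \[ p_{a_m}(n)=2n+2(B^j-1)\quad\text{for } 2B^j-B^{j-1}+2\le n\le B^{j+1}+1. \] (Thus the phase lengths at level $j$ are $B^{j-1}(B-1)$ for the first range and $B^{j-1}(B-1)^2$ for the second.)
   Context: For $n\ge0$ write $b_p(n)=\lfloor n/2^p\rfloor\bmod 2$; $\oplus$ is XOR and $\&$ is bitwise AND. For $m\ge0$, $a_m(n)=\bigoplus_{p\ge0,\ p\,\&\,m=0} b_p(n)$. For an infinite word $w$, $p_w(n)$ denotes the number of distinct factors (contiguous finite subwords) of $w$ of length $n$. *)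

(* Defs.v *)
From mathcomp Require Import all_boot.
From mathcomp Require Import boolp.

Set Implicit Arguments.
Unset Strict Implicit.
Unset Printing Implicit Defensive.

(* The binary digit floor(n / 2^p) mod 2, as a boolean, so that XOR is addb. *)
Definition bit (p n : nat) : bool := odd (n %/ 2 ^ p).

(* The XOR over all p >= 0 with p & m = 0. It is cut off at p < n because
   bit p n = false for p >= n; see a_bound for independence of the cutoff. *)
Definition a (m n : nat) : bool :=
  \big[addb/false]_(0 <= p < n | Nat.land p m == 0) bit p n.

Lemma bit_small (p n : nat) : n <= p -> bit p n = false.
Proof.
move=> np; rewrite /bit divn_small //.
by apply: leq_ltn_trans np _; apply: ltn_expl.
Qed.

Lemma a_bound (m n N : nat) : n <= N ->
  a m n = \big[addb/false]_(0 <= p < N | Nat.land p m == 0) bit p n.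
Proof.
move=> nN; rewrite (@big_cat_nat _ _ _ n) //=.
rewrite [X in _ (+) X]big_nat_cond [X in _ (+) X]big1 ?addbF //.
by move=> p /andP[/andP[np _] _]; exact: bit_small.
Qed.

Section FactorComplexity.
Variable T : finType.
Implicit Type w : nat -> T.

Definition factor_at w (n i : nat) : n.-tuple T := [tuple w (i + k) | k < n].

Definition is_factor w (n : nat) (u : n.-tuple T) : Prop :=
  exists i, u = factor_at w n i.

(* `[< _ >] is the classical truth value: i ranges over all of nat. *)
Definition factor_complexity w (n : nat) : nat :=
  #|[set u : n.-tuple T | `[< is_factor w u >]]|.

End FactorComplexity.

(* Main.v *)
(** Only the binary digits at multiples of 2^K count, that is, the lowest bit of
    each base-B digit, so w = a_m satisfies w(n) = w(n / B) (+) odd n: it is fixed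
    by the B-uniform substitution 0 -> (01)^(B/2), 1 -> (10)^(B/2).  Equal
    consecutive letters occur only at block boundaries, so a factor that does not
    alternate determines its phase modulo B, and it then corresponds to a unique
    nonconstant factor at the scale of blocks.  As w has no cube of a letter,
    alternating factors have length at most 2B, and constant ones at most 2.
    Summing over the phases gives, for P(x) = p_w(x + 1), q >= 2 and r <= B,
    P(Bq + r) = (B - r) P(q) + r P(q + 1), which propagates the piecewise linear
    shape of P from level j to level j + 1. *)
From Stdlib Require Import PeanoNat.
Require Import Defs.
From mathcomp Require Import all_boot.
From mathcomp Require Import boolp zify.

Set Implicit Arguments.
Unset Strict Implicit.
Unset Printing Implicit Defensive.

(** * Self-similarity of the word in base [2 ^ 2 ^ K] *)

Lemma land_pred_pow2 (p K : nat) : Nat.land p (2 ^ K - 1) = p %% 2 ^ K.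
Proof.
have pow2E : 2 ^ K = Nat.pow 2 K by elim: K => //= K <-; rewrite expnS; lia.
have -> : 2 ^ K - 1 = Nat.ones K by rewrite Nat.ones_equiv pow2E; lia.
rewrite Nat.land_ones -pow2E.
have : 0 < 2 ^ K by rewrite expn_gt0.
move: (2 ^ K) => d d0.
by apply/esym/(@Nat.mod_unique _ _ (p %/ d)); lia.
Qed.

(** The retained digit positions are the multiples of [2 ^ K]: position 0 gives [odd n], and
    lowering the others by [2 ^ K] divides [n] by [2 ^ 2 ^ K]. *)
Lemma a_div (K n : nat) :
  a (2 ^ K - 1) n = a (2 ^ K - 1) (n %/ 2 ^ 2 ^ K) (+) odd n.
Proof.
set L := 2 ^ K.
have L0 : 0 < L by rewrite expn_gt0.
(* The cutoffs [L + n] and [n] make both ranges match after a shift by [L]. *)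
rewrite (@a_bound _ n (L + n)) ?leq_addl // (@a_bound _ _ n) ?leq_div //.
rewrite (@big_cat_nat _ _ _ L) ?leq_addr //= addbC; congr addb.
  rewrite -{1}[L]add0n big_addn addKn.
  apply: eq_big => [p|p _].
    by rewrite !land_pred_pow2 -/L modnDr.
  by rewrite /bit expnD mulnC divnMA.
rewrite (@big_cat_nat _ _ _ 1) //= big_mkcond big_nat1 /=.
rewrite {1}/bit expn0 divn1.
rewrite big_nat_cond big_pred0 ?addbF // => p.
rewrite {2}/L land_pred_pow2 -/L.
by case: ltnP => //= p0; case: ltnP => //= pL; rewrite modn_small ?eqn0Ngt ?p0.
Qed.

Lemma sum_floor (f : nat -> nat) (d q r : nat) : 0 < d -> r <= d ->
  \sum_(i < d) f ((i + (d * q + r)) %/ d) = (d - r) * f q + r * f q.+1.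
Proof.
move=> d0 rd; rewrite -(big_mkord xpredT (fun i => f ((i + (d * q + r)) %/ d))).
rewrite (@big_cat_nat _ _ _ (d - r)) ?leq_subr //=; congr addn.
  rewrite (eq_big_nat _ _ (F2 := fun=> f q)) ?sum_nat_const_nat ?subn0 //.
  move=> i /andP[_ ir]; rewrite addnCA mulnC divnMDl // divn_small ?addn0 //.
  by lia.
rewrite (eq_big_nat _ _ (F2 := fun=> f q.+1)) ?sum_nat_const_nat ?subKn //.
move=> i /andP[ri id]; rewrite addnCA.
have -> : d * q + (i + r) = q.+1 * d + (i + r - d) by lia.
by rewrite divnMDl // divn_small ?addn0 //; lia.
Qed.

(** * Factors following a pattern up to complement *)

Section Patterns.
Variable w : nat -> bool.

Definition factors n : {set n.-tuple bool} :=
  [set u : n.-tuple bool | `[< is_factor w u >]].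

Lemma factorsP n (u : n.-tuple bool) :
  reflect (exists x, u = factor_at w n x) (u \in factors n).
Proof. by rewrite inE; exact: asboolP. Qed.

Lemma nth_mktuple_lt (f : nat -> bool) n k : k < n ->
  nth false [tuple f i | i < n] k = f k.
Proof. by move=> kn; rewrite -[k]/(val (Ordinal kn)) -tnth_nth tnth_mktuple. Qed.

Lemma eq_tuple_nth n (u v : n.-tuple bool) :
  (forall k, k < n -> nth false u k = nth false v k) -> u = v.
Proof. by move=> uv; apply/eq_from_tnth => i; rewrite !(tnth_nth false) uv. Qed.

Lemma nth_factor_at n x k : k < n -> nth false (factor_at w n x) k = w (x + k).
Proof. exact: (nth_mktuple_lt (fun k => w (x + k))). Qed.

(* Equal to [s] up to complementation: [s = xpred0] gives the constant words,
   [s = odd] the alternating ones. *)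
Definition follows (s : nat -> bool) n (u : n.-tuple bool) :=
  [forall k : 'I_n, nth false u k == nth false u 0 (+) s k].

Lemma followsP s n (u : n.-tuple bool) :
  reflect (forall k, k < n -> nth false u k = nth false u 0 (+) s k)
          (follows s u).
Proof.
apply: (iffP forallP) => [h k kn|h k]; last by apply/eqP/h.
exact: (eqP (h (Ordinal kn))).
Qed.

Definition nb_follows s n := #|[set u in factors n | follows s u]|.

(** The first letter determines such a factor, and both choices occur. *)
Lemma nb_follows2 s n : s 0 = false -> 0 < n ->
  (forall b, exists x, forall k, k < n -> w (x + k) = b (+) s k) ->
  nb_follows s n = 2.
Proof.
move=> s0 n0 occ; pose t b := [tuple b (+) s i | i < n].
have tE b k : k < n -> nth false (t b) k = b (+) s k.
  exact: (nth_mktuple_lt (fun k => b (+) s k)).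
have t_inj : injective t.
  move=> b c /(congr1 (fun u => nth false (val u) 0)).
  by rewrite /= !tE // s0 !addbF.
rewrite -card_bool -(card_imset _ t_inj); congr #|pred_of_set _|.
apply/setP => u; rewrite inE; apply/andP/imsetP.
  move=> [_ /followsP uE]; exists (nth false u 0) => //.
  by apply: eq_tuple_nth => k kn; rewrite tE // uE.
move=> [b _ ->]; split; last by apply/followsP => k kn; rewrite !tE // s0 addbF.
have [x xE] := occ b; apply/factorsP; exists x.
by apply: eq_tuple_nth => k kn; rewrite tE // nth_factor_at // xE.
Qed.

Lemma nb_follows0 s n : 0 < n ->
  (forall x, ~ forall k, k < n -> w (x + k) = w x (+) s k) ->
  nb_follows s n = 0.
Proof.
move=> n0 nocc; apply/eqP; rewrite cards_eq0; apply/eqP/setP => u.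
rewrite !inE; apply/negP => /andP[/asboolP[x ->]] /followsP xE; apply: (nocc x).
by move=> k kn; have := xE k kn; rewrite !nth_factor_at // addn0.
Qed.

Lemma factor_complexity_split s n : factor_complexity w n =
  nb_follows s n + #|[set u in factors n | ~~ follows s u]|.
Proof.
rewrite /factor_complexity -/(factors n) /nb_follows.
by rewrite -(cardsID [set u | follows s u]); congr addn; apply: eq_card => u;
  rewrite !inE // andbC.
Qed.

End Patterns.

(** * Repetitions in a word fixed by the substitution *)

Section Desubstitution.
Variables (w : nat -> bool) (B : nat).
Hypotheses (B2 : 2 < B) (Beven : ~~ odd B).
Hypotheses (wE : forall n, w n = w (n %/ B) (+) odd n).

Let B0 : 0 < B. Proof. by lia. Qed.

Lemma w_block q i : i < B -> w (B * q + i) = w q (+) odd i.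
Proof.
move=> iB; rewrite wE mulnC divnMDl // divn_small // addn0 oddD oddM.
by rewrite (negbTE Beven) andbF.
Qed.

Lemma w_repeat n : w n = w n.+1 -> n.+1 %% B = 0.
Proof.
rewrite {1}(divn_eq n B) mulnC => E.
have [lt|ge] := ltnP (n %% B).+1 B.
  move: E; rewrite [in w n.+1](divn_eq n B) -addnS [_ * B]mulnC !w_block //=.
    by case: (w _); case: (odd _).
  by rewrite ltn_mod.
have r1 : n %% B = B.-1 by have := ltn_pmod n B0; lia.
by rewrite -addn1 -modnDml r1 addn1 prednK // modnn.
Qed.

Lemma w_boundary q : w (B * q + B.-1) = ~~ w q.
Proof.
rewrite w_block; last by lia.
suff -> : odd B.-1 by rewrite addbT.
by move: Beven; rewrite -{1}(prednK B0) /= negbK.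
Qed.

(** Otherwise two consecutive integers would both be multiples of [B]. *)
Lemma no_cube q : w q = w q.+1 -> w q.+1 <> w q.+2.
Proof.
move=> /w_repeat h1 /w_repeat h2.
have : B %| q.+2 - q.+1 by rewrite dvdn_sub // /dvdn ?h1 ?h2.
by rewrite subSnn dvdn1; lia.
Qed.

Hypothesis w_start : w 0 = false.

(** A block ends with the complement of its first letter, so blocks of opposite types meet in a
    square; blocks 0, 1 and 1, 2 supply both letters. *)
Lemma square b : exists q, w q = b /\ w q.+1 = b.
Proof.
have odd1 : w 1 by rewrite wE divn_small ?w_start //; lia.
have even2 : w 2 = false by rewrite wE divn_small ?w_start.
case: b.
  exists (B * 0 + B.-1); rewrite w_boundary w_start; split=> //.
  have -> : (B * 0 + B.-1).+1 = B * 1 + 0 by lia.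
  by rewrite w_block // addbF.
exists (B * 1 + B.-1); rewrite w_boundary odd1; split=> //.
have -> : (B * 1 + B.-1).+1 = B * 2 + 0 by lia.
by rewrite w_block // addbF.
Qed.

Lemma nb_constant n : 0 < n -> nb_follows w xpred0 n = (n <= 2) * 2.
Proof.
move=> n0; case: leqP => n2.
  apply: nb_follows2 => // b; have [q [h0 h1]] := square b; exists q => k kn.
  rewrite addbF; have : k < 2 by lia.
  by case: k {kn} => [|[|]]; rewrite ?addn0 ?addn1.
apply: nb_follows0 => // q h.
have h1 := h 1 (ltnW n2); have h2 := h 2 n2.
rewrite !addbF addn1 addn2 in h1 h2.
by apply: (@no_cube q); rewrite ?h1 ?h2.
Qed.

(** Length [2 * B] is reached by the image of a square, two equal adjacent blocks. *)
Lemma nb_alternating n : 0 < n -> nb_follows w odd n = (n <= 2 * B) * 2.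
Proof.
move=> n0; case: leqP => n2.
  apply: nb_follows2 => // b; have [q [h0 h1]] := square b; exists (B * q) => k kn.
  have [kB|kB] := ltnP k B; first by rewrite w_block ?h0.
  have -> : B * q + k = B * q.+1 + (k - B) by lia.
  by rewrite w_block ?h1 ?oddB ?(negbTE Beven) ?addbF //; lia.
apply: nb_follows0 => // x h.
(* An alternating factor longer than [2 * B] crosses two consecutive block
   boundaries, which forces three equal letters in a row. *)
have step k : k.+1 < n -> w (x + k) = ~~ w (x + k).+1.
  move=> kn; rewrite -addnS !h //; last by lia.
  by rewrite /= addbN negbK.
have xE := divn_eq x B; have xB := ltn_pmod x B0.
set q := x %/ B in xE.
(* The end of block [q + t] and the start of the next both lie in the factor, since [2 * B < n];
   alternation there forces a repetition in [w] at [q + t]. *)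
have bnd t : t < 2 -> w (q + t) = w (q + t).+1.
  move=> t2; have := step (B * t + B.-1 - x %% B).
  have -> : x + (B * t + B.-1 - x %% B) = B * (q + t) + B.-1.
    by rewrite {1}xE; nia.
  have -> : (B * (q + t) + B.-1).+1 = B * (q + t).+1 + 0 by nia.
  rewrite w_boundary w_block // addbF => H; apply: negb_inj.
  apply: H; nia.
have := bnd 0 isT; have := bnd 1 isT; rewrite addn0 addn1 => h1 h0.
exact: (no_cube h0 h1).
Qed.

(** * Desubstitution of non-alternating factors *)

Lemma repeat_of_not_alternating n (u : n.-tuple bool) : ~~ follows odd u ->
  exists k, k.+1 < n /\ nth false u k = nth false u k.+1.
Proof.
move=> /followsP nalt; apply: contrapT => norep; apply: nalt.
elim=> [|k IH] kn; first by rewrite addbF.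
have := IH (ltnW kn); have [E|] := eqVneq (nth false u k) (nth false u k.+1).
  by case: norep; exists k.
by rewrite /= addbN => /eqP + <-; case: (nth _ _ k); case: (nth _ _ k.+1).
Qed.

(* The factor of length [n] read from offset [i] in the image of [v]. *)
Definition read_image n i c (v : c.-tuple bool) : n.-tuple bool :=
  [tuple nth false v ((i + k) %/ B) (+) odd (i + k) | k < n].

Lemma nth_read_image n i c (v : c.-tuple bool) k : k < n ->
  nth false (read_image n i v) k = nth false v ((i + k) %/ B) (+) odd (i + k).
Proof.
exact: (nth_mktuple_lt (fun k => nth false v ((i + k) %/ B) (+) odd (i + k))).
Qed.

Section Phase.
Variables (x i : nat).
Hypothesis iB : i < B.
(** Number of blocks met by a window of length [x.+1] starting at offset [i]. *)
Let c := ((i + x) %/ B).+1.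

Let index_lt k : k < x.+1 -> (i + k) %/ B < c.
Proof. by move=> kx; rewrite ltnS leq_div2r // leq_add2l. Qed.

Let index_onto t : t < c -> exists2 k, k < x.+1 & (i + k) %/ B = t.
Proof.
rewrite ltnS leq_divRL // => tc; case: t tc => [|t] tc.
  by exists 0; rewrite // addn0 divn_small.
exists (t.+1 * B - i); first by lia.
by rewrite subnKC ?mulnK //; nia.
Qed.

Lemma read_image_factor y :
  factor_at w x.+1 (B * y + i) = read_image x.+1 i (factor_at w c y).
Proof.
apply: eq_tuple_nth => k kx.
rewrite nth_read_image // !nth_factor_at // ?index_lt // wE -addnA mulnC divnMDl //.
by rewrite oddD oddM (negbTE Beven) andbF.
Qed.

(** The window meets every block, and one letter of a block determines its type. *)
Lemma read_image_inj : injective (@read_image x.+1 i c).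
Proof.
move=> u v uv; apply: eq_tuple_nth => t /index_onto[k kx <-].
have := congr1 (fun u => nth false (val u) k) uv.
by rewrite /= !nth_read_image //; move/addIb.
Qed.

Lemma alternating_read_image (v : c.-tuple bool) :
  follows odd (read_image x.+1 i v) = follows xpred0 v.
Proof.
apply/followsP/followsP => h.
  move=> t /index_onto[k kx <-]; rewrite addbF.
  have := h k kx; rewrite !nth_read_image // addn0 (divn_small iB) oddD addbA.
  by move/addIb/addIb.
move=> k kx; rewrite !nth_read_image // addn0 (divn_small iB) oddD addbA.
by rewrite h ?index_lt // addbF.
Qed.

End Phase.

Lemma card_not_alternating x :
  #|[set u in factors w x.+1 | ~~ follows odd u]| =
  \sum_(i < B) #|[set v in factors w ((i + x) %/ B).+1 | ~~ follows xpred0 v]|.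
Proof.
pose S (i : 'I_B) : {set x.+1.-tuple bool} := @read_image x.+1 i _ @:
  [set v in factors w ((i + x) %/ B).+1 | ~~ follows xpred0 v].
have S_phase i u : u \in S i ->
  ~~ follows odd u /\ exists y, u = factor_at w x.+1 (B * y + i).
  case/imsetP => v; rewrite inE => /andP[/factorsP[y ->] nc] ->.
  by rewrite alternating_read_image //; split=> //; exists y;
    rewrite read_image_factor.
have disj i j : i != j -> [disjoint S i & S j].
  move=> ij; apply/pred0P => u /=; apply/negP => /andP[].
  move=> /S_phase[nalt [y uy]] /S_phase[_ [z uz]].
  have [k [kx rep]] := repeat_of_not_alternating nalt.
  (* Position [k.+1] of the repetition starts a block, which fixes [i'] modulo [B]. *)
  have phase y' i' : u = factor_at w x.+1 (B * y' + i') -> i' + k.+1 = 0 %[mod B].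
    move=> uE; move: rep; rewrite uE !nth_factor_at ?(ltnW kx) // addnS.
    by move=> /w_repeat; rewrite -addnA -addnS mulnC modnMDl mod0n addnS.
  move: ij; rewrite -val_eqE => /eqP; apply.
  have /eqP := etrans (phase _ _ uy) (esym (phase _ _ uz)).
  by rewrite eqn_modDr !modn_small // => /eqP.
rewrite -sum1_card.
transitivity (\sum_(u in \bigcup_i S i) 1).
  apply: eq_bigl => u; rewrite inE; apply/andP/bigcupP.
    move=> [/factorsP[y uy] nalt]; exists (Ordinal (ltn_pmod y B0)) => //.
    have E : u = read_image x.+1 (y %% B) (factor_at w ((y %% B + x) %/ B).+1 (y %/ B)).
      by rewrite -read_image_factor ?ltn_mod // mulnC -divn_eq.
    apply/imsetP; exists (factor_at w ((y %% B + x) %/ B).+1 (y %/ B)) => //.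
    rewrite inE -(@alternating_read_image x _ (ltn_pmod y B0)) -E nalt andbT.
    by apply/factorsP; exists (y %/ B).
  move=> [i _ /S_phase[nalt [y uy]]]; split=> //.
  by apply/factorsP; exists (B * y + i).
rewrite partition_disjoint_bigcup //; apply: eq_bigr => i _.
by rewrite sum1_card card_imset //; exact: read_image_inj.
Qed.

(** * The recurrence for the complexity and its solution *)

Lemma factor_complexity_nonconstant c :
  #|[set v in factors w c.+1 | ~~ follows xpred0 v]| =
  factor_complexity w c.+1 - (c <= 1) * 2.
Proof. by rewrite (factor_complexity_split w xpred0) nb_constant // addKn. Qed.

Lemma factor_complexity_rec q r : r <= B ->
  factor_complexity w (B * q + r).+1 = (B * q + r < 2 * B) * 2 +
    ((B - r) * (factor_complexity w q.+1 - (q <= 1) * 2) +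
     r * (factor_complexity w q.+2 - (q < 1) * 2)).
Proof.
move=> rB; rewrite (factor_complexity_split w odd) nb_alternating //.
rewrite card_not_alternating; congr addn.
rewrite (sum_floor (fun c => #|[set v in factors w c.+1 | ~~ follows xpred0 v]|)) //.
by rewrite !factor_complexity_nonconstant.
Qed.

(** For [q = r = 0] the recurrence reads [p - 2 = B * (p - 2)], which forces [p = 2]. *)
Lemma factor_complexity1 : factor_complexity w 1 = 2.
Proof.
have := @factor_complexity_rec 0 0 isT; have := factor_complexity_split w xpred0 1.
rewrite nb_constant // !muln0 subn0 addn0 muln_gt0 B0 !mul1n.
by move: (factor_complexity w 1) => p; nia.
Qed.

(** At length 2, nonconstant means alternating, so the count is 2 + 2. *)
Lemma factor_complexity2 : factor_complexity w 2 = 4.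
Proof.
rewrite (factor_complexity_split w xpred0) nb_constant //.
suff -> : [set u in factors w 2 | ~~ follows xpred0 u] =
          [set u in factors w 2 | follows odd u].
  by have := nb_alternating (isT : 0 < 2); rewrite /nb_follows => ->; lia.
apply/setP => u; rewrite !inE; congr andb.
apply/idP/followsP => [/followsP nc [|[|k]] // _|alt].
- by rewrite addbF.
- rewrite addbT; apply: contra_notP nc => E [|[|k]] // _; rewrite addbF //.
  by move: E; do 2!case: (nth _ _ _).
- by apply/followsP => /(_ 1 isT); rewrite alt //=; case: (nth _ _ _).
Qed.

Lemma factor_complexity_le n : 0 < n <= B.+1 -> factor_complexity w n = 2 * n.
Proof.
case: n => // x /= xB; have := @factor_complexity_rec 0 x xB.
rewrite muln0 !add0n factor_complexity1 factor_complexity2 => ->.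
by have -> : x < 2 * B; lia.
Qed.

Lemma factor_complexity_gt q r : 1 < q -> r <= B ->
  factor_complexity w (B * q + r).+1 =
    (B - r) * factor_complexity w q.+1 + r * factor_complexity w q.+2.
Proof.
move=> q1 rB; rewrite factor_complexity_rec //.
have -> : (B * q + r < 2 * B) = false by nia.
have -> : (q <= 1) = false by lia.
have -> : (q < 1) = false by lia.
by rewrite !subn0.
Qed.

Lemma factor_complexity_level1 x : B <= x < 2 * B ->
  factor_complexity w x.+1 = 4 * x - 2 * (B - 1).
Proof.
move=> /andP[Bx xB]; have rB : x - B <= B by lia.
have := @factor_complexity_rec 1 (x - B) rB.
rewrite muln1 subnKC // xB factor_complexity2 (@factor_complexity_le 3);
  last by lia.
by rewrite !leqnn ltnn !mul1n mul0n subn0 => ->; lia.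
Qed.

(** Here [x] is the length minus one. The recurrence interpolates affinely between multiples of [B],
    and the breakpoints of level [j.+1] are [B] times those of level [j]. The closed ranges share
    endpoints, where the formulas agree. *)
Lemma factor_complexity_gt_level j x : 0 < j ->
  (B ^ j <= x <= 2 * B ^ j - B ^ j.-1 ->
     factor_complexity w x.+1 = 4 * x - 2 * (B ^ j - B ^ j.-1)) /\
  (2 * B ^ j - B ^ j.-1 <= x <= B ^ j.+1 ->
     factor_complexity w x.+1 = 2 * x + 2 * B ^ j).
Proof.
elim: j x => // j IH x _; rewrite (divn_eq x B) mulnC.
set q := x %/ B; have := ltn_pmod x B0; set r := x %% B => rB.
case: j IH => [|j] IH.
  rewrite expn1 expn0; split=> xr; first by apply: factor_complexity_level1; lia.
  (* The only point with [q <= 1] is [x = 2 * B - 1], the endpoint shared with the first range. *)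
  have [q1|q1] := ltnP 1 q; last first.
    by rewrite factor_complexity_level1; nia.
  rewrite factor_complexity_gt ?(ltnW rB) //.
  have qB : q <= B by move: xr; rewrite expnS expn1; nia.
  rewrite factor_complexity_le; last by lia.
  case: (posnP r) => [->|r0]; first by nia.
  rewrite factor_complexity_le; first by nia.
  by move: xr; rewrite expnS expn1; nia.
have [IH1 IH2] := (fun y => proj1 (IH y isT), fun y => proj2 (IH y isT)).
have pB : 0 < B ^ j by rewrite expn_gt0 B0.
move: IH1 IH2; rewrite /= !expnS; set P := B ^ j in pB *.
move=> IH1 IH2; split=> xr.
  have q1 : 1 < q by nia.
  rewrite factor_complexity_gt ?(ltnW rB) // IH1; last by nia.
  (* If [r = 0], the point [q.+1] may leave the range, but its coefficient vanishes. *)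
  case: (posnP r) => [->|r0]; first by nia.
  by rewrite IH1; nia.
have q1 : 1 < q by nia.
rewrite factor_complexity_gt ?(ltnW rB) // IH2; last by nia.
case: (posnP r) => [->|r0]; first by nia.
by rewrite IH2; nia.
Qed.

End Desubstitution.

Theorem theorem47 (K m B : nat) (hK : 1 <= K)
    (hm : m = 2 ^ K - 1) (hB : B = 2 ^ (2 ^ K)) :
  (forall n, 1 <= n <= B + 1 -> factor_complexity (a m) n = 2 * n) /\
  (forall j, 1 <= j ->
    [/\ forall n, B ^ j + 2 <= n <= 2 * B ^ j - B ^ (j - 1) + 1 ->
          factor_complexity (a m) n = 4 * n - 2 * (B ^ j - B ^ (j - 1) + 2),
        forall n, 2 * B ^ j - B ^ (j - 1) + 2 <= n <= B ^ (j + 1) + 1 ->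
          factor_complexity (a m) n = 2 * n + 2 * (B ^ j - 1),
        (* numbers of integers n in the two ranges *)
        (2 * B ^ j - B ^ (j - 1) + 1).+1 - (B ^ j + 2) = B ^ (j - 1) * (B - 1)
      & (B ^ (j + 1) + 1).+1 - (2 * B ^ j - B ^ (j - 1) + 2)
          = B ^ (j - 1) * (B - 1) ^ 2]).
Proof.
have L1 : 1 < 2 ^ K by rewrite -{1}(expn0 2) ltn_exp2l.
have B2 : 2 < B by rewrite hB -{1}(expn1 2) ltn_exp2l.
have Beven : ~~ odd B by rewrite hB oddX negb_or; lia.
have wE n : a m n = a m (n %/ B) (+) odd n by rewrite hm hB a_div.
have w0 : a m 0 = false by rewrite /a big_geq.
split=> [n nB|]; first by apply: (factor_complexity_le B2 Beven wE w0); lia.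
case=> // j _; rewrite subSS subn0 !addn1 !expnS.
have level x := @factor_complexity_gt_level _ _ B2 Beven wE w0 j.+1 x isT.
move: level; rewrite /= !expnS => level.
have P0 : 0 < B ^ j by rewrite expn_gt0; lia.
move: level P0; set P := B ^ j => level P0; split; first last.
- rewrite expn0 muln1; have -> : B = (B - 1).+1 by lia.
  by move: (B - 1) => c; rewrite subn1 /=; nia.
- nia.
(* Substituting [n = x.+1] matches the constants of the two formulas. *)
- by case=> [|x] xr; [lia|rewrite (proj2 (level x)); nia].
by case=> [|x] xr; [lia|rewrite (proj1 (level x)); nia].
Qed.
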